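(* For each $\varepsilon\in\{-,+\}$, the composition $\circ$ restricted to $\mathcal{I}_1^{\varepsilon}$ makes $(\mathcal{I}_1^{\varepsilon},\circ)$ a group. Moreover, the groups $(\mathcal{I}_1^{+},\circ)$ and $(\mathcal{I}_1^{-},\circ)$ are isomorphic.
   Context: $\mathbb{N}=\{0,1,2,\dots\}$, $[+\infty]=\mathbb{N}$ and $[-\infty]=-\mathbb{N}=\{\dots,-2,-1,0\}$. For $\varepsilon\in\{+,-\}$, $\mathcal{I}_1^{\varepsilon}$ is the set of families $S=(s(i))_{i\in[\varepsilon\infty]}$ of natural numbers which are injective (distinct indices give distinct values) and whose set of values is all of $\mathbb{N}$; i.e. bijections $s:[\varepsilon\infty]\to\mathbb{N}$. Composition: for $S=(s(i))_{i\in[\varepsilon\infty]}$ and $U=(u(j))_{j\in[\varepsilon\infty]}$ in $\mathcal{I}_1^{\varepsilon}$, $S\circ U=(r(j))_{j\in[\varepsilon\infty]}$ with $r(j)=s(\varepsilon\,u(j))$, where $\varepsilon u(j)$ means $u(j)$ if $\varepsilon=+$ and $-u(j)$ if $\varepsilon=-$. *)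

(* Defs.v *)
From HB Require Import structures.
From mathcomp Require Import all_boot all_order all_algebra.
From mathcomp Require Import boolp classical_sets.

Set Implicit Arguments.
Unset Strict Implicit.
Unset Printing Implicit Defensive.

Import Order.TTheory GRing.Theory Num.Theory.
Local Open Scope classical_set_scope.
Local Open Scope ring_scope.

Inductive sign := Plus | Minus.

Definition apply_sign (eps : sign) (z : int) : int :=
  if eps is Plus then z else - z.

Definition in_ix (eps : sign) (i : int) : bool :=
  if eps is Plus then 0 <= i else i <= 0.

Definition ix (eps : sign) : Type := {i : int | in_ix eps i}.

Lemma in_ix_apply_sign (eps : sign) (n : nat) :
  in_ix eps (apply_sign eps n%:Z).
Proof. by case: eps; rewrite /= ?oppr_le0. Qed.

Definition signed_ix (eps : sign) (n : nat) : ix eps :=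
  exist _ (apply_sign eps n%:Z) (in_ix_apply_sign eps n).

Definition fam (eps : sign) : Type := ix eps -> nat.

Definition I1 (eps : sign) : set (fam eps) :=
  [set s | injective s /\ range s = [set: nat]].
Arguments I1 : clear implicits.

(* Defined on all families: that I1 is stable is part of [group_under]. *)
Definition fam_comp (eps : sign) (s u : fam eps) : fam eps :=
  fun j => s (signed_ix eps (u j)).

(* [Group.axioms_ A] is the class of [groupType] structures carried by the
   subset A, seen as a type; the equation makes A stable under op and
   determines the product of the structure. *)
Definition group_under (T : Type) (A : set T) (op : T -> T -> T)
    (G : Group.axioms_ A) : Prop :=
  forall x y : Group.Pack G, val (x * y)%g = op (val x) (val y).

Definition isomorphic_groups (G H : groupType) : Prop :=
  exists f : {multiplicative G -> H}, bijective f.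

(* Main.v *)
Require Import Defs.
From HB Require Import structures.
From mathcomp Require Import all_boot all_order all_algebra.
From mathcomp Require Import boolp classical_sets.

Set Implicit Arguments.
Unset Strict Implicit.
Unset Printing Implicit Defensive.

(** Both index sets are copies of the natural numbers, through
    [n |-> eps * n], whose inverse is the absolute value [ix_abs]. Under this
    identification a family in [I1 eps] is a permutation of the natural
    numbers, and [fam_comp] is nothing but composition of permutations: this is
    the group structure, with the absolute value as identity element. As the
    permutation group obtained does not depend on the sign, substituting one
    index set for the other ([reindex]) is a group isomorphism.

    Concretely, every family involved is a composite of bijections with
    [signed_ix] and [ix_abs], hence a bijection, which is what membership in
    [I1] means ([I1_bijective]); the group laws and the morphism property then
    reduce to the cancellations [signed_ixK] and [ix_absK]. *)

Definition ix_abs (eps : sign) (i : ix eps) : nat := absz (val i).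

Lemma signed_ixK (eps : sign) : cancel (signed_ix eps) (@ix_abs eps).
Proof. by move=> n; rewrite /ix_abs; case: eps => //=; rewrite abszN. Qed.

Lemma ix_absK (eps : sign) : cancel (@ix_abs eps) (signed_ix eps).
Proof.
move=> [i Hi]; apply: val_inj; rewrite /ix_abs /=.
by case: eps Hi => /= Hi; [rewrite gez0_abs | rewrite lez0_abs ?GRing.opprK].
Qed.

Lemma I1_bijective (eps : sign) (s : fam eps) : I1 eps s <-> bijective s.
Proof.
split=> [[s_inj s_onto]|[t sK tK]].
  have s_surj n : exists i, s i = n.
    by have: [set: nat]%classic n by []; rewrite -s_onto => -[i _ <-]; exists i.
  have [t tK] := choice s_surj.
  by exists t => // i; apply: s_inj.
split; first exact: can_inj sK.
by apply/seteqP; split=> // n _; exists (t n).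
Qed.

Lemma signed_ix_bijective (eps : sign) : bijective (signed_ix eps).
Proof. by exists (@ix_abs eps); [exact: signed_ixK | exact: ix_absK]. Qed.

Lemma ix_abs_bijective (eps : sign) : bijective (@ix_abs eps).
Proof. by exists (signed_ix eps); [exact: ix_absK | exact: signed_ixK]. Qed.

(** The group structure is attached to a name of its own, so that it does not
    become visible on arbitrary subsets viewed as types. *)
Definition bij_fam (eps : sign) : Type := I1 eps.

HB.instance Definition _ (eps : sign) :=
  Choice.copy (bij_fam eps) {f : fam eps | f \in I1 eps}.

Section BijFam.
Variable eps : sign.
Implicit Types s u : bij_fam eps.

Definition fam_of s : fam eps := val s.

Lemma fam_of_bijective s : bijective (fam_of s).
Proof. exact/I1_bijective/set_mem/(valP s). Qed.

Definition BijFam (f : fam eps) (f_bij : bijective f) : bij_fam eps :=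
  SigSub (mem_set (iffRL (I1_bijective f) f_bij)).

Lemma fam_ofE (f : fam eps) (f_bij : bijective f) : fam_of (BijFam f_bij) = f.
Proof. by []. Qed.

Lemma bij_fam_eq s u : fam_of s =1 fam_of u -> s = u.
Proof. by move=> su; apply: val_inj; apply/funext. Qed.

Lemma fam_comp_bijective (f g : fam eps) :
  bijective f -> bijective g -> bijective (fam_comp f g).
Proof.
move=> f_bij g_bij.
exact: bij_comp f_bij (bij_comp (signed_ix_bijective eps) g_bij).
Qed.

Definition bij_fam_mul s u : bij_fam eps :=
  BijFam (fam_comp_bijective (fam_of_bijective s) (fam_of_bijective u)).

Definition bij_fam_one : bij_fam eps := BijFam (ix_abs_bijective eps).

Lemma fam_of_mul s u j :
  fam_of (bij_fam_mul s u) j = fam_of s (signed_ix eps (fam_of u j)).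
Proof. by []. Qed.

Lemma fam_of_one j : fam_of bij_fam_one j = ix_abs j.
Proof. by []. Qed.

(** The inverse map of [s] sends values to indices; composing it on both sides
    with the absolute value makes it a family again. *)
Lemma bij_fam_inv_exists s :
  exists u, bij_fam_mul u s = bij_fam_one.
Proof.
have [t sK tK] := fam_of_bijective s.
have inv_bij : bijective (@ix_abs eps \o t \o @ix_abs eps).
  have t_bij : bijective t by exists (fam_of s).
  have abs_bij := ix_abs_bijective eps.
  exact: bij_comp (bij_comp abs_bij t_bij) abs_bij.
exists (BijFam inv_bij); apply: bij_fam_eq => j.
by rewrite fam_of_mul fam_ofE /= signed_ixK sK.
Qed.

Definition bij_fam_inv s : bij_fam eps := sval (cid (bij_fam_inv_exists s)).

Lemma bij_fam_mulA : associative bij_fam_mul.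
Proof. by move=> s u v; apply: bij_fam_eq. Qed.

Lemma bij_fam_mul1 : left_id bij_fam_one bij_fam_mul.
Proof.
by move=> s; apply: bij_fam_eq => j; rewrite fam_of_mul fam_of_one signed_ixK.
Qed.

Lemma bij_fam_mulr1 : right_id bij_fam_one bij_fam_mul.
Proof.
by move=> s; apply: bij_fam_eq => j; rewrite fam_of_mul fam_of_one ix_absK.
Qed.

Lemma bij_fam_mulV : left_inverse bij_fam_one bij_fam_inv bij_fam_mul.
Proof. by move=> s; rewrite /bij_fam_inv; case: cid. Qed.

Lemma bij_fam_mulrV : right_inverse bij_fam_one bij_fam_inv bij_fam_mul.
Proof.
(* A left inverse is two-sided since it has a left inverse itself. *)
move=> s; set t := bij_fam_inv s.
rewrite -[LHS]bij_fam_mul1 -{1}(bij_fam_mulV t) -bij_fam_mulA.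
by rewrite (bij_fam_mulA t) (bij_fam_mulV s) bij_fam_mul1 bij_fam_mulV.
Qed.

HB.instance Definition _ := isGroup.Build (bij_fam eps)
  bij_fam_mulA bij_fam_mul1 bij_fam_mulr1 bij_fam_mulV bij_fam_mulrV.

End BijFam.

Definition reindex (eps eta : sign) (f : fam eps) : fam eta :=
  f \o signed_ix eps \o @ix_abs eta.
Arguments reindex {eps} eta f.

Lemma reindex_bijective (eps eta : sign) (f : fam eps) :
  bijective f -> bijective (reindex eta f).
Proof.
move=> f_bij.
have ix_bij := bij_comp f_bij (signed_ix_bijective eps).
exact: bij_comp ix_bij (ix_abs_bijective eta).
Qed.

Definition bij_reindex (eps eta : sign) (s : bij_fam eps) : bij_fam eta :=
  BijFam (reindex_bijective eta (fam_of_bijective s)).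

Lemma fam_of_reindex (eps eta : sign) (s : bij_fam eps) j :
  fam_of (bij_reindex eta s) j = fam_of s (signed_ix eps (ix_abs j)).
Proof. by []. Qed.

Lemma bij_reindexK (eps eta : sign) :
  cancel (@bij_reindex eps eta) (@bij_reindex eta eps).
Proof.
move=> s; apply: bij_fam_eq => j.
by rewrite !fam_of_reindex signed_ixK ix_absK.
Qed.

Lemma bij_reindexM (eps eta : sign) :
  {morph @bij_reindex eps eta : s u / (s * u)%g}.
Proof.
move=> s u; apply: bij_fam_eq => j.
by rewrite fam_of_reindex !fam_of_mul !fam_of_reindex signed_ixK.
Qed.

HB.instance Definition _ (eps eta : sign) :=
  isMultiplicative.Build (bij_fam eps) (bij_fam eta) (@bij_reindex eps eta)
    (@bij_reindexM eps eta).

Theorem proposition5p4 :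
  exists G : forall eps : sign, Group.axioms_ (I1 eps),
    (forall eps : sign, group_under (@fam_comp eps) (G eps)) /\
    isomorphic_groups (Group.Pack (G Plus)) (Group.Pack (G Minus)).
Proof.
exists (fun eps => Group.class (bij_fam eps)); split=> [eps s u //|].
exists (@bij_reindex Plus Minus).
by exists (@bij_reindex Minus Plus); exact: bij_reindexK.
Qed.
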